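(* Let $A=(V_A,E_A)$ and $B=(V_B,E_B)$ be finite simple graphs on disjoint vertex sets $V_A$ and $V_B$. Let $V=V_A\cup V_B$ and let $G=A+B=(V,E_A\cup E_B)$. Let $C=(V,E_C)$ be a simple graph with at least one edge, every edge of which joins a vertex of $V_A$ to a vertex of $V_B$. Assume that $$\lambda(A)\unlhd d^T(A),\qquad \lambda(B)\unlhd d^T(B),\qquad \lambda(C)\unlhd d^T(C).$$ Assume additionally that $d^T_i(C)\le d^T_i(A)$ and $d^T_i(C)\le d^T_i(B)$ for all $i\ge 1$, and that $d^T_1(B)\le d^T_m(A)$, where $m$ is the largest index with $d^T_m(C)\neq 0$ (equivalently, $m$ is the maximum vertex degree in $C$). Let $H=C\cup G=(V,E_A\cup E_B\cup E_C)$. Then $$\lambda(H)\unlhd d^T(H).$$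
   Context: For a finite simple graph $X$ with $n$ vertices $v_1,\dots,v_n$, the combinatorial Laplacian $L(X)$ is the $n\times n$ matrix with $L(X)_{ii}=\deg(v_i)$, $L(X)_{ij}=-1$ if $\{v_i,v_j\}$ is an edge, and $L(X)_{ij}=0$ otherwise. It is positive semidefinite, and $\lambda(X)=(\lambda_1\ge\lambda_2\ge\dots\ge\lambda_n=0)$ denotes its eigenvalues listed in non-increasing order with multiplicity. The degree sequence $d(X)$ is the sequence of vertex degrees of $X$ in non-increasing order. Its conjugate $d^T(X)$ is the sequence with $d^T_j(X)=|\{v : \deg_X(v)\ge j\}|$ for $j\ge 1$. Trailing zeros may be added to or dropped from sequences as needed, so that sequences being compared have a common length. For non-increasing real sequences $s,t$ of length $n$, $s\unlhd t$ (''$s$ is majorized by $t$'') means $\sum_{i=1}^k s_i\le\sum_{i=1}^k t_i$ for all $k\le n$, and $\sum_{i=1}^n s_i=\sum_{i=1}^n t_i$. *)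

(* Defs.v *)
From mathcomp Require Import all_boot all_order all_algebra.
From mathcomp Require Import polyrcf.

Set Implicit Arguments.
Unset Strict Implicit.
Unset Printing Implicit Defensive.

Import Order.TTheory GRing.Theory Num.Theory.
Local Open Scope ring_scope.

Record sgraph (V : finType) := SGraph {
  adj :> rel V;
  adj_sym : symmetric adj;
  adj_irr : irreflexive adj
}.

Section GraphOperations.
Variables VA VB V : finType.

Definition disjoint_union_adj (A : sgraph VA) (B : sgraph VB) : rel (VA + VB) :=
  fun x y => match x, y with
             | inl a, inl a' => A a a'
             | inr b, inr b' => B b b'
             | _, _ => false
             end.

Lemma disjoint_union_sym A B : symmetric (disjoint_union_adj A B).
Proof. by case=> [a|b] [a'|b'] //=; exact: adj_sym. Qed.

Lemma disjoint_union_irr A B : irreflexive (disjoint_union_adj A B).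
Proof. by case=> [a|b] /=; exact: adj_irr. Qed.

Definition disjoint_union (A : sgraph VA) (B : sgraph VB) : sgraph (VA + VB)%type :=
  SGraph (disjoint_union_sym A B) (disjoint_union_irr A B).

Definition graph_union_adj (X Y : sgraph V) : rel V := fun x y => X x y || Y x y.

Lemma graph_union_sym X Y : symmetric (graph_union_adj X Y).
Proof. by move=> x y; rewrite /graph_union_adj !(adj_sym _ x y). Qed.

Lemma graph_union_irr X Y : irreflexive (graph_union_adj X Y).
Proof. by move=> x; rewrite /graph_union_adj !adj_irr. Qed.

Definition graph_union (X Y : sgraph V) : sgraph V :=
  SGraph (graph_union_sym X Y) (graph_union_irr X Y).

Definition deg (X : sgraph V) (v : V) : nat := #|[set w | X v w]|.

(* Meaningful for j >= 1 only: the conjugate sequence is indexed from 1. *)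
Definition conj_deg (X : sgraph V) (j : nat) : nat := #|[set v | (j <= deg X v)%N]|.

(* The vertices are numbered by the enumeration of V; the spectrum does not
   depend on this choice. *)
Definition laplacian (R : rcfType) (X : sgraph V) : 'M[R]_#|V| :=
  \matrix_(i, j)
    if i == j then (deg X (enum_val i))%:R
    else if X (enum_val i) (enum_val j) then -1 else 0.

(* The entries are d^T_1, ..., d^T_#|V|; all later terms vanish because degrees
   are smaller than #|V|. *)
Definition conj_deg_seq (R : rcfType) (X : sgraph V) : seq R :=
  mkseq (fun i => (conj_deg X i.+1)%:R) #|V|.

End GraphOperations.

(* The roots in R of the characteristic polynomial, each repeated according to
   its algebraic multiplicity, in non-increasing order. A symmetric matrix has
   all its eigenvalues in the real closed field R, so nothing is lost there. *)
Definition eigenvalues (R : rcfType) n (M : 'M[R]_n) : seq R :=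
  sort (fun x y => y <= x)
    (flatten [seq nseq (mup x (char_poly M)) x | x <- rootsR (char_poly M)]).

Lemma mem_eigenvalues (R : rcfType) n (M : 'M[R]_n) x :
  (x \in eigenvalues M) = eigenvalue M x.
Proof.
have p0 : char_poly M != 0 by rewrite monic_neq0 ?char_poly_monic.
rewrite mem_sort eigenvalue_root_char.
have rE y : (y \in rootsR (char_poly M)) = root (char_poly M) y.
  by have /(_ y) := roots_on_rootsR p0; rewrite inE.
apply/flatten_mapP/idP => [[y]|rx].
  by rewrite rE mem_nseq => ry /andP[_ /eqP->].
exists x; first by rewrite rE.
by rewrite mem_nseq eqxx andbT -XsubC_dvd // dvdp_XsubCl.
Qed.

Lemma eigenvalues_split (R : rcfType) n (M : 'M[R]_n) (s : seq R) :
  char_poly M = \prod_(x <- s) ('X - x%:P) ->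
  eigenvalues M = sort (fun x y => y <= x) s.
Proof.
move=> Ms; have p0 : char_poly M != 0 by rewrite monic_neq0 ?char_poly_monic.
have rE y : (y \in rootsR (char_poly M)) = root (char_poly M) y.
  by have /(_ y) := roots_on_rootsR p0; rewrite inE.
have totge : total (fun x y : R => y <= x) by move=> x y; exact: le_total.
have trge : transitive (fun x y : R => y <= x).
  by move=> y x z yx zy; exact: le_trans zy yx.
have asge : antisymmetric (fun x y : R => y <= x).
  by move=> x y; rewrite andbC; exact: le_anti.
apply/(perm_sortP totge trge asge)/allP => y _ /=; apply/eqP.
have -> : count_mem y s = mup y (char_poly M) by rewrite Ms mu_prod_XsubC.
rewrite count_flatten -map_comp sumnE big_map.
rewrite (eq_bigr (fun x => if x == y then mup y (char_poly M) else 0%N)); last first.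
  by move=> x _ /=; rewrite count_nseq /=; case: eqP => [->|]; rewrite ?mul1n ?mul0n.
rewrite -big_mkcond big_const_seq iter_addn_0.
rewrite (eq_count (a2 := pred1 y)) // count_uniq_mem ?uniq_roots // rE.
by case: (boolP (root _ y)) => [_|/mupNroot->]; rewrite ?muln1.
Qed.

Definition laplacian_spectrum (R : rcfType) (V : finType) (X : sgraph V) : seq R :=
  eigenvalues (laplacian R X).

(* Intended for sequences already in non-increasing order. The default value of
   s`_i past the end of s is 0, which pads the shorter sequence with zeros. *)
Definition majorized (R : rcfType) (s t : seq R) : Prop :=
  let n := maxn (size s) (size t) in
  (forall k, (k <= n)%N -> \sum_(i < k) s`_i <= \sum_(i < k) t`_i) /\
  \sum_(i < n) s`_i = \sum_(i < n) t`_i.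

(* Main.v *)
(* Since L(H) = L(C) + L(G), Ky Fan's inequality bounds the sum of the k largest
   eigenvalues of H by the one for C plus the one for G. The spectrum of G merges
   those of A and B, so the latter is the sum of the i largest eigenvalues of A
   and the j largest of B for some i + j = k. Writing D_k(X) for
   d^T_1(X) + ... + d^T_k(X) = \sum_v min(deg_X v, k), it remains to see that
   D_k(C) + D_i(A) + D_j(B) <= D_k(H). As d^T_1(B) <= d^T_m(A), trading a term of
   B for one of A while i < m only increases the left-hand side, so one may assume
   j = 0 or i >= m. Then, for suitable l <= r (namely 0 <= k, 0 <= 0 or j <= m),
   summing an inequality valid at each vertex leaves
   D_r(C) - D_l(C) <= D_r(B) - D_l(B), which follows from d^T(C) <= d^T(B). *)
Require Import Defs.
From mathcomp Require Import all_boot all_order all_algebra.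
From mathcomp Require Import perm sesquilinear spectral complex zify ring.

Set Implicit Arguments.
Unset Strict Implicit.
Unset Printing Implicit Defensive.

(** * Conjugate degree sequences *)

Lemma sum_nat_leq_minn (k d : nat) : \sum_(i < k) (i < d) = minn d k.
Proof.
elim: k => [|k IHk]; first by rewrite big_ord0; lia.
by rewrite big_ord_recr /= IHk; case: ltnP; lia.
Qed.

(** Double counting of the pairs [(i, v)] with [i < k] and [i < deg X v]. The right-hand side can
    then be estimated vertex by vertex. *)
Lemma sum_conj_deg (V : finType) (X : sgraph V) k :
  \sum_(i < k) conj_deg X i.+1 = \sum_v minn (deg X v) k.
Proof.
transitivity (\sum_(i < k) \sum_v ((i < deg X v)%N : nat)).
  apply: eq_bigr => i _; rewrite /conj_deg -sum1_card big_mkcond /=.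
  by apply: eq_bigr => v _; rewrite inE; case: ltnP.
by rewrite exchange_big /=; apply: eq_bigr => v _; rewrite sum_nat_leq_minn.
Qed.

Lemma conj_deg_antitone (V : finType) (X : sgraph V) i j :
  (i <= j)%N -> (conj_deg X j <= conj_deg X i)%N.
Proof.
move=> le_ij; apply: subset_leq_card; apply/subsetP => v; rewrite !inE.
exact: leq_trans.
Qed.

Lemma deg_lt_card (V : finType) (X : sgraph V) v : (deg X v < #|V|)%N.
Proof.
rewrite -cardsT; apply: proper_card; rewrite properT.
by apply/eqP => /setP /(_ v); rewrite !inE adj_irr.
Qed.

Lemma conj_deg_gt_card (V : finType) (X : sgraph V) i :
  (#|V| <= i)%N -> conj_deg X i = 0.
Proof.
move=> le_Vi; apply: eq_card0 => v; rewrite !inE leqNgt.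
by rewrite (leq_trans (deg_lt_card X v)).
Qed.

(** * Degree inequalities for a graph whose edges all cross between the two sides *)

Section CrossGraph.
Variables (VA VB : finType) (A : sgraph VA) (B : sgraph VB).
Variable C : sgraph (VA + VB)%type.
Hypothesis C_across : forall x y, C x y ->
  exists a b, (x = inl a /\ y = inr b) \/ (x = inr b /\ y = inl a).

Let H := graph_union C (disjoint_union A B).

Lemma cross_disjoint x y : C x y -> disjoint_union A B x y = false.
Proof. by case/C_across => a [b [[-> ->]|[-> ->]]]. Qed.

Lemma deg_graph_union x : deg H x = (deg C x + deg (disjoint_union A B) x)%N.
Proof.
rewrite /deg -cardsUI [X in (_ = _ + X)%N]eq_card0 ?addn0; last first.
  by move=> y; rewrite !inE; apply/andP => -[/cross_disjoint->].
by apply: eq_card => y; rewrite !inE.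
Qed.

Lemma deg_disjoint_union_inl a : deg (disjoint_union A B) (inl a) = deg A a.
Proof.
rewrite /deg -(card_imset _ (@inl_inj VA VB)); apply: eq_card => y.
rewrite !inE; case: y => [a'|b] /=.
  by rewrite mem_imset ?inE //; exact: inl_inj.
by apply/esym/imsetP => -[].
Qed.

Lemma deg_disjoint_union_inr b : deg (disjoint_union A B) (inr b) = deg B b.
Proof.
rewrite /deg -(card_imset _ (@inr_inj VA VB)); apply: eq_card => y.
rewrite !inE; case: y => [a|b'] /=.
  by apply/esym/imsetP => -[].
by rewrite mem_imset ?inE //; exact: inr_inj.
Qed.

Hypothesis CleB : forall i, (1 <= i)%N -> (conj_deg C i <= conj_deg B i)%N.
Variable m : nat.
Hypothesis m_max : forall j, (m < j)%N -> conj_deg C j = 0%N.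
Hypothesis BleA : (conj_deg B 1 <= conj_deg A m)%N.

Lemma deg_cross_le x : (deg C x <= m)%N.
Proof.
have /card0_eq/(_ x) := m_max (ltnSn m); rewrite !inE; lia.
Qed.

(** While [i < m], the last term of [B] is at most [conj_deg B 1 <= conj_deg A m <= conj_deg A
    i.+1], so it may be traded for the next term of [A]. Each trade lowers [j], hence the induction
    on [j]. *)
Lemma conj_deg_exchange i j : exists i' j',
  [/\ (i' + j' = i + j)%N, j' = 0%N \/ (m <= i')%N &
    (\sum_(l < i) conj_deg A l.+1 + \sum_(l < j) conj_deg B l.+1 <=
     \sum_(l < i') conj_deg A l.+1 + \sum_(l < j') conj_deg B l.+1)%N].
Proof.
elim: j i => [|j IHj] i; first by exists i, 0%N; split=> //; left.
have [le_mi|lt_im] := leqP m i; first by exists i, j.+1; split=> //; right.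
have [i' [j' [ij Hm le_D]]] := IHj i.+1; exists i', j'; split=> //; first lia.
apply: leq_trans le_D; rewrite !big_ord_recr /=.
have := conj_deg_antitone A lt_im; have := @conj_deg_antitone _ B 1 j.+1 isT; lia.
Qed.

(** The terms of index [j + 1] to [k] compare one by one. Differences of partial sums are written
    with the subtracted sums moved across, as subtraction in [nat] truncates. *)
Lemma sum_conj_deg_tail j k : (j <= k)%N ->
  (\sum_(l < k) conj_deg C l.+1 + \sum_(l < j) conj_deg B l.+1 <=
   \sum_(l < k) conj_deg B l.+1 + \sum_(l < j) conj_deg C l.+1)%N.
Proof.
elim: k => [|k IHk]; first by rewrite leqn0 => /eqP->; rewrite addnC.
rewrite leq_eqVlt => /predU1P[->|/IHk le_k]; first by rewrite addnC.
by rewrite !big_ord_recr /= addnAC [leqRHS]addnAC leq_add ?CleB.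
Qed.

Lemma sum_conj_deg_union i j :
  (\sum_(l < i + j) conj_deg C l.+1 +
     (\sum_(l < i) conj_deg A l.+1 + \sum_(l < j) conj_deg B l.+1) <=
   \sum_(l < i + j) conj_deg H l.+1)%N.
Proof.
have [i' [j' [<- ij /(leq_add (leqnn _))le_D]]] := conj_deg_exchange i j.
(* From here on [i] and [j] denote the exchanged pair, with [j = 0] or [m <= i]. *)
apply: leq_trans (le_D _) _; move: i' j' ij {i j le_D} => i j ij.
have degHl a : deg H (inl a) = (deg C (inl a) + deg A a)%N.
  by rewrite deg_graph_union deg_disjoint_union_inl.
have degHr b : deg H (inr b) = (deg C (inr b) + deg B b)%N.
  by rewrite deg_graph_union deg_disjoint_union_inr.
have split_sum (F : VA + VB -> nat) :
    (\sum_x F x = \sum_a F (inl a) + \sum_b F (inr b))%N.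
  exact: big_sumType.
have tail l r : (l <= r)%N ->
  (\sum_a minn (deg C (inl a)) r + \sum_b minn (deg C (inr b)) r +
     \sum_b minn (deg B b) l <=
   \sum_b minn (deg B b) r +
     (\sum_a minn (deg C (inl a)) l + \sum_b minn (deg C (inr b)) l))%N.
  by move/sum_conj_deg_tail; rewrite !sum_conj_deg !split_sum.
rewrite !sum_conj_deg !split_sum.
under [X in (_ <= X + _)%N]eq_bigr => a _ do rewrite degHl.
under [X in (_ <= _ + X)%N]eq_bigr => b _ do rewrite degHr.
(* The vertexwise bounds carry correction terms truncated at [l] and [r]; after summation over all
   vertices, [tail] absorbs them. *)
have combine l r : (l <= r)%N ->
    (forall a, minn (deg C (inl a)) (i + j) + minn (deg A a) i +
      minn (deg C (inl a)) l <=
      minn (deg C (inl a) + deg A a) (i + j) + minn (deg C (inl a)) r)%N ->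
    (forall b, minn (deg C (inr b)) (i + j) + minn (deg B b) j +
        minn (deg B b) r + minn (deg C (inr b)) l <=
      minn (deg C (inr b) + deg B b) (i + j) + minn (deg C (inr b)) r +
        minn (deg B b) l)%N ->
  (\sum_a minn (deg C (inl a)) (i + j) + \sum_b minn (deg C (inr b)) (i + j) +
     (\sum_a minn (deg A a) i + \sum_b minn (deg B b) j) <=
   \sum_a minn (deg C (inl a) + deg A a) (i + j) +
     \sum_b minn (deg C (inr b) + deg B b) (i + j))%N.
  move=> /tail le_lr leA leB.
  have := leq_sum (index_enum VA) (fun a (_ : predT a) => leA a).
  have := leq_sum (index_enum VB) (fun b (_ : predT b) => leB b).
  rewrite /= !big_split /=; lia.
case: ij => [j0|le_mi].
  by apply: (@combine 0 i) => //= [a|b]; lia.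
(* If [m <= j], all degrees in [C] are at most [i] and at most [j], and [l = r = 0] makes the
   corrections vanish. If [j < m <= i], a degree in [C] may exceed [j]; on the side of [B] the
   truncation at [j] is then exchanged for one at [m]. *)
have [le_mj|lt_jm] := leqP m j.
  apply: (@combine 0 0) => // [a|b].
    have := deg_cross_le (inl a); lia.
  have := deg_cross_le (inr b); lia.
apply: (@combine j m) => [|a|b]; first exact: ltnW.
  have := deg_cross_le (inl a); lia.
have := deg_cross_le (inr b); lia.
Qed.

End CrossGraph.

Import Order.TTheory GRing.Theory Num.Theory.
Local Open Scope ring_scope.
Local Open Scope sesquilinear_scope.

(** * Weighted sums and matrices with orthonormal rows *)

Section WeightedSum.
Variable C : numDomainType.

(** The threshold [t] separates the first [k] values from the others, so [(d i - t) * (1 - w i)] for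
    the former and [(t - d i) * w i] for the latter are nonnegative. Summing gives the claim because
    the weights add up to [k]. *)
Lemma weighted_sum_le (n k : nat) (d w : 'I_n -> C) (t : C) : (k <= n)%N ->
    (forall i : 'I_n, (i < k)%N -> t <= d i) ->
    (forall i : 'I_n, (k <= i)%N -> d i <= t) ->
    (forall i, 0 <= w i <= 1) -> \sum_i w i = k%:R ->
  \sum_i d i * w i <= \sum_(i < n | (i < k)%N) d i.
Proof.
move=> le_kn dge dle w01 sum_w.
have sum_k : \sum_(i < n | (i < k)%N) t = t * k%:R.
  by rewrite -(big_ord_widen _ (fun=> t)) // sumr_const card_ord mulr_natr.
apply: (@le_trans _ _ (\sum_i (t * w i + (if (i < k)%N then d i - t else 0)))).
  apply: ler_sum => i _; have /andP[w0 w1] := w01 i; rewrite -subr_ge0.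
  case: ltnP => [/dge d_ge|/dle d_le].
    rewrite (_ : _ - _ = (d i - t) * (1 - w i)); last by ring.
    by rewrite mulr_ge0 ?subr_ge0.
  rewrite (_ : _ - _ = (t - d i) * w i); last by ring.
  by rewrite mulr_ge0 ?subr_ge0.
by rewrite big_split /= -mulr_sumr sum_w -big_mkcond sumrB sum_k addrC subrK.
Qed.

End WeightedSum.

Section Unitary.
Variable C : numClosedFieldType.

(** The rows of [W] are orthonormal, so [Q = W^t* *m W] is an orthogonal projection. A diagonal
    entry [q] of [Q] is the squared norm of its row, whence [q * q <= q]. *)
Lemma unitarymx_col_le1 k n (W : 'M[C]_(k, n)) j : W \is unitarymx ->
  0 <= \sum_a W a j * (W a j)^* <= 1.
Proof.
move=> /unitarymxP WW; pose Q := W^t* *m W.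
have Qjj : Q j j = \sum_a W a j * (W a j)^*.
  by rewrite mxE; apply: eq_bigr => a _; rewrite !mxE mulrC.
have QQ : Q *m Q = Q by rewrite /Q mulmxA -(mulmxA _ W) WW mulmx1.
have Qherm : Q^t* = Q by rewrite /Q trmx_mul map_mxM /= trmxCK.
have Qsq : Q j j = \sum_l Q j l * (Q j l)^*.
  rewrite -{1}QQ mxE; apply: eq_bigr => l _; congr (_ * _).
  by rewrite -{1}Qherm !mxE.
have Q0 : 0 <= Q j j by rewrite Qjj sumr_ge0 // => a _; exact: mul_conjC_ge0.
rewrite -Qjj Q0 /=; have: Q j j * (Q j j)^* <= Q j j.
  rewrite {3}Qsq (bigD1 j) //= lerDl sumr_ge0 // => l _.
  exact: mul_conjC_ge0.
rewrite (CrealP (ger0_real Q0)); case: (eqVneq (Q j j) 0) => [->|Qn0] //.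
by rewrite -[X in _ <= X]mulr1 ler_pM2l // lt_def Qn0.
Qed.

Lemma tr_unitarymx k n (W : 'M[C]_(k, n)) : W \is unitarymx ->
  \sum_j \sum_a W a j * (W a j)^* = k%:R.
Proof.
move=> /unitarymxP/(congr1 mxtrace); rewrite mxtrace1 => <-.
rewrite exchange_big; apply: eq_bigr => a _; rewrite mxE.
by apply: eq_bigr => j _; rewrite !mxE.
Qed.

(** This presents the trace as a weighted sum of the [d 0 j], the weights being the squared column
    norms of [W]. *)
Lemma tr_conj_diag k n (W : 'M[C]_(k, n)) (d : 'rV[C]_n) :
  \tr (W *m diag_mx d *m W^t*) = \sum_j d 0 j * \sum_a W a j * (W a j)^*.
Proof.
rewrite /mxtrace; under eq_bigr => a _ do rewrite mxE.
rewrite exchange_big; apply: eq_bigr => j _; rewrite mulr_sumr.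
apply: eq_bigr => a _; rewrite mul_mx_diag !mxE; ring.
Qed.

End Unitary.

Lemma unitarymx_rowsub (C : numClosedFieldType) k n (f : 'I_k -> 'I_n)
    (P : 'M[C]_n) : injective f -> P \is unitarymx -> rowsub f P \is unitarymx.
Proof.
move=> f_inj /unitarymxP PP; apply/unitarymxP/matrixP => i j.
have /matrixP/(_ (f i) (f j)) := PP; rewrite !mxE (inj_eq f_inj) => <-.
by apply: eq_bigr => l _; rewrite !mxE.
Qed.

Lemma char_poly_conj (R : comNzRingType) n (P Q M : 'M[R]_n) : Q *m P = 1%:M ->
  char_poly (Q *m M *m P) = char_poly M.
Proof.
move=> QP; have QPpoly : map_mx polyC Q *m map_mx polyC P = 1%:M.
  by rewrite -map_mxM QP map_mx1.
rewrite /char_poly /char_poly_mx.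
have -> : 'X%:M - map_mx polyC (Q *m M *m P) =
    map_mx polyC Q *m ('X%:M - map_mx polyC M) *m map_mx polyC P.
  rewrite mulmxBr mulmxBl -!map_mxM /= mul_mx_scalar -scalemxAl QPpoly.
  by rewrite scalemx1.
by rewrite !det_mulmx mulrAC -det_mulmx QPpoly det1 mul1r.
Qed.

(** * Spectral theorem for real symmetric matrices and Ky Fan's inequality *)

Section SymmetricSpectrum.
Variable R : rcfType.
Local Notation toC := (real_complex R).

(** Over [R[i]] the matrix is hermitian, so the complex spectral theorem gives a unitary
    diagonalization with real diagonal. Permuting the rows of the unitary matrix puts the diagonal
    in the order of [eigenvalues M]. *)
Lemma symmetric_diagonalization n (M : 'M[R]_n) : M^T = M ->
  char_poly M = \prod_(x <- eigenvalues M) ('X - x%:P) /\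
  exists2 P : 'M[R[i]]_n, P \is unitarymx &
    map_mx toC M = P^t* *m diag_mx (\row_i toC (eigenvalues M)`_i) *m P.
Proof.
move=> Msym; set MC := map_mx toC M.
have MC_real : MC \is a mxOver Num.real.
  by apply/mxOverP => i j; rewrite mxE; apply/complex_realP; exists (M i j).
have MC_sym : MC \is symmetricmx.
  by apply/is_hermitianmxP; rewrite expr0 scale1r map_mx_id // /MC map_trmx Msym.
have MC_herm := realsym_hermsym MC_sym MC_real.
have MCE := elimT (@orthomx_spectralP _ _ _) (hermitian_normalmx MC_herm).
have Dreal := hermitian_spectral_diag_real MC_herm.
have Punit := spectral_unitarymx MC; rewrite invmx_unitary // in MCE.
set P := spectralmx MC in MCE Punit; set D := spectral_diag MC in MCE Dreal.
pose d : n.-tuple R := [tuple complex.Re (D 0 i) | i < n].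
have DE i : D 0 i = toC (tnth d i).
  by rewrite tnth_mktuple RRe_real //; exact: (mxOverP Dreal).
have char_MC : char_poly MC = \prod_i ('X - (D 0 i)%:P).
  rewrite MCE char_poly_conj; last first.
    by rewrite -invmx_unitary ?mulVmx ?unitarymx_unit.
  rewrite char_poly_trig; last exact: diag_mx_is_trig.
  by apply: eq_bigr => i _; rewrite mxE eqxx mulr1n.
have char_M : char_poly M = \prod_(x <- d) ('X - x%:P).
  apply: (map_poly_inj toC); rewrite map_char_poly char_MC rmorph_prod big_tuple.
  by apply: eq_bigr => i _; rewrite DE rmorphB /= map_polyX map_polyC.
have eigE := eigenvalues_split char_M.
have eig_d : perm_eq (eigenvalues M) d by rewrite eigE perm_sort.
split; first by rewrite char_M; apply/esym/perm_big.
case/tuple_permP: eig_d => s sE.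
exists (rowsub s P).
  exact: (unitarymx_rowsub (@perm_inj _ s) Punit).
rewrite MCE; apply/matrixP => i j; rewrite !mul_mx_diag !mxE.
rewrite (reindex_inj (@perm_inj _ s)); apply: eq_bigr => l _; rewrite !mxE.
by congr (_ * _ * _); rewrite DE sE (nth_map l) ?size_enum_ord // nth_ord_enum.
Qed.

Lemma size_symmetric_eigenvalues n (M : 'M[R]_n) : M^T = M ->
  size (eigenvalues M) = n.
Proof.
case/symmetric_diagonalization => /(congr1 (fun p : {poly R} => size p)) + _.
by rewrite size_char_poly size_prod_XsubC => -[].
Qed.

Lemma eigenvalues_nonincreasing n (M : 'M[R]_n) i j :
  (i <= j)%N -> (j < size (eigenvalues M))%N ->
  (eigenvalues M)`_j <= (eigenvalues M)`_i.
Proof.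
move=> le_ij lt_j; pose ge (x y : R) := y <= x.
have ge_tr : transitive ge by move=> y x z yx zy; exact: le_trans zy yx.
have ge_sorted : sorted ge (eigenvalues M).
  by apply: sort_sorted => x y; exact: (le_total y x).
apply: (sorted_leq_nth ge_tr (fun x => lexx x) 0 ge_sorted) => //.
by rewrite inE (leq_ltn_trans le_ij).
Qed.

(** The inequality half of Ky Fan's maximum principle: in an eigenbasis the trace is a sum of
    eigenvalues whose weights lie between 0 and 1 and add up to [k]. *)
Lemma tr_compression_le n k (M : 'M[R]_n) (U : 'M[R[i]]_(k, n)) :
    M^T = M -> (k <= n)%N -> U \is unitarymx ->
  \tr (U *m map_mx toC M *m U^t*) <= toC (\sum_(i < k) (eigenvalues M)`_i).
Proof.
move=> Msym le_kn Uu; have sz := size_symmetric_eigenvalues Msym.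
have [_ [P Pu ->]] := symmetric_diagonalization Msym.
set d := \row_i _; pose W := U *m P^t*.
have Wu : W \is unitarymx by rewrite mul_unitarymx ?trmxC_unitary.
have -> : U *m (P^t* *m diag_mx d *m P) *m U^t* = W *m diag_mx d *m W^t*.
  by rewrite /W trmx_mul map_mxM /= trmxCK !mulmxA.
have le_toC x y : x <= y -> toC x <= toC y by rewrite lecR.
(* The threshold is the [k]-th largest eigenvalue, at index [k.-1]. For [k = 0] it is the largest
   one, which still bounds all the others. *)
rewrite tr_conj_diag; pose t := toC (eigenvalues M)`_k.-1.
have -> : toC (\sum_(i < k) (eigenvalues M)`_i) =
    \sum_(i < n | (i < k)%N) d 0 i.
  rewrite (big_ord_widen _ (fun i => (eigenvalues M)`_i) le_kn) rmorph_sum.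
  by apply: eq_bigr => i _; rewrite mxE.
apply: (weighted_sum_le (t := t)) => // [i lt_ik|i le_ki|i|].
- rewrite mxE; apply/le_toC/eigenvalues_nonincreasing; rewrite ?sz.
    by rewrite -ltnS prednK // (leq_ltn_trans _ lt_ik).
  by rewrite prednK // (leq_ltn_trans _ lt_ik).
- rewrite mxE; apply/le_toC/eigenvalues_nonincreasing; rewrite ?sz //.
  exact: leq_trans (leq_pred _) le_ki.
- exact: unitarymx_col_le1.
- exact: tr_unitarymx.
Qed.

(** The first [k] rows of the diagonalizing unitary matrix belong to the [k] largest eigenvalues and
    attain the bound. *)
Lemma tr_compression_attained n k (M : 'M[R]_n) : M^T = M -> (k <= n)%N ->
  exists2 U : 'M[R[i]]_(k, n), U \is unitarymx &
    \tr (U *m map_mx toC M *m U^t*) = toC (\sum_(i < k) (eigenvalues M)`_i).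
Proof.
move=> /symmetric_diagonalization[_ [P Pu ME]] le_kn.
pose f := widen_ord le_kn; exists (rowsub f P).
  by apply: unitarymx_rowsub => // i j fij; exact/val_inj/(congr1 val fij).
rewrite ME; set d := \row_i _; rewrite /mxtrace rmorph_sum.
apply: eq_bigr => i _; have /unitarymxP PP := Pu.
transitivity ((P *m (P^t* *m diag_mx d *m P) *m P^t*) (f i) (f i)).
  rewrite !mxE; apply: eq_bigr => j _; rewrite !mxE; congr (_ * _).
  by apply: eq_bigr => l _; rewrite !mxE.
rewrite !mulmxA PP mul1mx -mulmxA PP mulmx1.
by rewrite mxE eqxx mulr1n mxE.
Qed.

(** For a [U] attaining the sum for [M + N], the trace splits into the traces for [M] and for [N],
    each bounded by the maximum principle. *)
Lemma ky_fan n (M N : 'M[R]_n) k : M^T = M -> N^T = N -> (k <= n)%N ->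
  \sum_(i < k) (eigenvalues (M + N))`_i <=
  \sum_(i < k) (eigenvalues M)`_i + \sum_(i < k) (eigenvalues N)`_i.
Proof.
move=> Ms Ns le_kn; have MNs : (M + N)^T = M + N by rewrite linearD /= Ms Ns.
have [U Uu trU] := tr_compression_attained MNs le_kn.
rewrite -lecR -trU map_mxD mulmxDr mulmxDl mxtraceD rmorphD.
by apply: lerD; exact: tr_compression_le.
Qed.

Lemma sum_eigenvalues n (M : 'M[R]_n) : M^T = M ->
  \sum_(i < n) (eigenvalues M)`_i = \tr M.
Proof.
move=> /symmetric_diagonalization[_ [P /unitarymxP PP ME]].
apply: (@complexI R); rewrite -trace_map_mx ME mxtrace_mulC mulmxA PP mul1mx.
rewrite mxtrace_diag rmorph_sum; by apply: eq_bigr => i _; rewrite mxE.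
Qed.

End SymmetricSpectrum.

(** * Merged sequences and renumbered matrices *)

(** Each step of [merge] outputs the head of [s] or of [t], so a prefix of the result is made of a
    prefix of [s] and a prefix of [t]. *)
Lemma sum_take_merge (R : nmodType) (r : rel R) (s t : seq R) k :
  (k <= size s + size t)%N ->
  exists i j, [/\ (i + j = k)%N, (i <= size s)%N, (j <= size t)%N &
    \sum_(x <- take k (merge r s t)) x =
    \sum_(x <- take i s) x + \sum_(x <- take j t) x].
Proof.
elim: s t k => [|x s IHs] t k.
  by exists 0%N, k; rewrite take0 big_nil add0r; split.
elim: t k => [|y t IHt] k le_k.
  by exists k, 0%N; rewrite take0 big_nil addr0; split; rewrite ?addn0 // -[size _]addn0.
case: k le_k => [|k] le_k; first by exists 0%N, 0%N; rewrite !take0 !big_nil addr0.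
rewrite [merge _ _ _]/=; case: ifP => _.
  have [i [j [ij si tj E]]] := IHs (y :: t) k le_k.
  exists i.+1, j; split=> //; first by rewrite addSn ij.
  by rewrite /= !big_cons E addrA.
have [|i [j [ij si tj E]]] := IHt k; first by move: le_k; rewrite /= addnS.
exists i, j.+1; split=> //; first by rewrite addnS ij.
by rewrite /= !big_cons -/(merge r (x :: s) t) E addrCA.
Qed.

Lemma sum_nth_take (R : nmodType) (s : seq R) k :
  \sum_(i < k) s`_i = \sum_(x <- take k s) x.
Proof.
elim: k s => [|k IHk] [|x s]; rewrite ?take0 ?big_ord0 ?big_nil //.
  by rewrite big1 // => i _; rewrite nth_nil.
by rewrite big_ord_recl /= big_cons IHk.
Qed.

(** The two numberings of [V] differ by a permutation that acts on both rows and columns, so its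
    sign occurs squared. *)
Lemma det_reindex (R : comNzRingType) (V : finType) n (f : 'I_n -> V)
    (F : V -> V -> R) : bijective f ->
  \det (\matrix_(i, j) F (f i) (f j)) =
  \det (\matrix_(i < #|V|, j < #|V|) F (enum_val i) (enum_val j)).
Proof.
move=> f_bij; have nV : n = #|V| by rewrite -(bij_eq_card f_bij) card_ord.
subst n; have r_inj : injective (enum_rank \o f).
  by apply: inj_comp (bij_inj f_bij); exact: enum_rank_inj.
pose s := perm r_inj; set M := \matrix_(i, j) F (enum_val i) _.
have -> : \matrix_(i, j) F (f i) (f j) = row_perm s (col_perm s M).
  by apply/matrixP => i j; rewrite !mxE !permE /= !enum_rankK.
rewrite row_permE col_permE !det_mulmx !det_perm odd_permV mulrCA.
by rewrite -signr_addb addbb mulr1.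
Qed.

Lemma char_poly_reindex (R : comNzRingType) (V : finType) n (f : 'I_n -> V)
    (F : V -> V -> R) : bijective f ->
  char_poly (\matrix_(i, j) F (f i) (f j)) =
  char_poly (\matrix_(i < #|V|, j < #|V|) F (enum_val i) (enum_val j)).
Proof.
(* [G] expresses the entries of the characteristic matrix through vertices; an injective numbering
   lets [x == y] stand for equality of indices. *)
move=> f_bij; pose G x y := 'X *+ (x == y) - (F x y)%:P.
have charE m (g : 'I_m -> V) : injective g ->
    char_poly (\matrix_(i, j) F (g i) (g j)) =
    \det (\matrix_(i, j) G (g i) (g j)).
  move=> g_inj; congr (\det _); apply/matrixP => i j.
  by rewrite !mxE /G (inj_eq g_inj).
rewrite !charE; [exact: det_reindex | exact: enum_val_inj | exact: bij_inj].
Qed.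

Lemma char_poly_block_diag (R : comNzRingType) m n (M : 'M[R]_m) (N : 'M[R]_n) :
  char_poly (block_mx M 0 0 N) = char_poly M * char_poly N.
Proof. by rewrite /char_poly char_block_diag_mx det_ublock. Qed.

(** * Laplacian spectra and their majorization *)

Section LaplacianSpectrum.
Variable R : rcfType.

(** Indexed by vertices instead of ordinals, so that any other numbering of the vertices can be
    substituted. *)
Definition laplacian_entry (V : finType) (X : sgraph V) (x y : V) : R :=
  if x == y then (deg X x)%:R else if X x y then -1 else 0.

Lemma laplacianE (V : finType) (X : sgraph V) :
  laplacian R X =
  \matrix_(i, j) laplacian_entry X (enum_val i) (enum_val j).
Proof.
apply/matrixP => i j; rewrite !mxE /laplacian_entry (inj_eq enum_val_inj).
by case: eqP => // ->.
Qed.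

Lemma laplacian_symmetric (V : finType) (X : sgraph V) :
  (laplacian R X)^T = laplacian R X.
Proof.
rewrite laplacianE; apply/matrixP => i j; rewrite !mxE /laplacian_entry.
by rewrite eq_sym adj_sym; case: eqP => // ->.
Qed.

Lemma size_laplacian_spectrum (V : finType) (X : sgraph V) :
  size (laplacian_spectrum R X) = #|V|.
Proof. exact/size_symmetric_eigenvalues/laplacian_symmetric. Qed.

Lemma sum_laplacian_spectrum (V : finType) (X : sgraph V) :
  \sum_(i < #|V|) (laplacian_spectrum R X)`_i = (\sum_v deg X v)%:R.
Proof.
rewrite (sum_eigenvalues (laplacian_symmetric X)) /mxtrace natr_sum.
rewrite [RHS](reindex _ (onW_bij _ (enum_val_bij V))).
by apply: eq_bigr => i _; rewrite mxE eqxx.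
Qed.

Lemma sum_conj_deg_seq (V : finType) (X : sgraph V) k :
  \sum_(i < k) (conj_deg_seq R X)`_i = (\sum_(i < k) conj_deg X i.+1)%:R.
Proof.
rewrite natr_sum; apply: eq_bigr => i _; rewrite /conj_deg_seq.
have [lt_iV|le_Vi] := ltnP i #|V|; first by rewrite nth_mkseq.
(* Past [#|V|] the default value 0 is the true value of [conj_deg], since degrees are below
   [#|V|]. *)
by rewrite nth_default ?size_mkseq // conj_deg_gt_card // (leq_trans le_Vi).
Qed.

(** Both totals equal the sum of the degrees: the spectrum sums to the trace, and
    [minn (deg X v) #|V|] is [deg X v]. The partial sums remain to be compared. *)
Lemma majorized_laplacianP (V : finType) (X : sgraph V) :
  majorized (laplacian_spectrum R X) (conj_deg_seq R X) <->
  forall k, (k <= #|V|)%N -> \sum_(i < k) (laplacian_spectrum R X)`_i <=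
    (\sum_(i < k) conj_deg X i.+1)%:R.
Proof.
rewrite /majorized size_laplacian_spectrum size_mkseq maxnn.
split=> [[le_k _] k /le_k|le_k]; first by rewrite sum_conj_deg_seq.
split=> [k|]; first by rewrite sum_conj_deg_seq; exact: le_k.
rewrite sum_laplacian_spectrum sum_conj_deg_seq sum_conj_deg.
congr (_%:R); apply: eq_bigr => v _.
by apply/esym/minn_idPl/ltnW/deg_lt_card.
Qed.

(** With the vertices of [A] numbered before those of [B], the Laplacian is block diagonal. Its
    characteristic polynomial factors, so the spectrum is the merge of the two spectra. *)
Lemma sum_spectrum_disjoint_union (VA VB : finType) (A : sgraph VA)
    (B : sgraph VB) k : (k <= #|VA| + #|VB|)%N ->
  exists i j, [/\ (i + j = k)%N, (i <= #|VA|)%N, (j <= #|VB|)%N &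
    \sum_(l < k) (laplacian_spectrum R (disjoint_union A B))`_l =
    \sum_(l < i) (laplacian_spectrum R A)`_l +
      \sum_(l < j) (laplacian_spectrum R B)`_l].
Proof.
set G := disjoint_union A B => le_k.
pose f (i : 'I_(#|VA| + #|VB|)) : VA + VB :=
  match split i with inl a => inl (enum_val a) | inr b => inr (enum_val b) end.
have f_bij : bijective f.
  pose g (x : VA + VB) : 'I_(#|VA| + #|VB|) :=
    unsplit (match x with inl a => inl (enum_rank a) | inr b => inr (enum_rank b) end).
  exists g => [i|x]; rewrite /f /g.
    by case: split_ordP => [a|b] ->; rewrite /= enum_valK.
  by case: x => x; rewrite unsplitK enum_rankK.
have char_G : char_poly (laplacian R G) =
    char_poly (laplacian R A) * char_poly (laplacian R B).
  rewrite [laplacian R G]laplacianE -(char_poly_reindex _ f_bij).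
  rewrite -char_poly_block_diag; congr (char_poly _); apply/matrixP => i j.
  rewrite mxE /f; case: (split_ordP i) => [a|b] ->; case: (split_ordP j) => [a'|b'] ->.
  - by rewrite block_mxEul laplacianE mxE /laplacian_entry /= deg_disjoint_union_inl.
  - by rewrite block_mxEur mxE.
  - by rewrite block_mxEdl mxE.
  - by rewrite block_mxEdr laplacianE mxE /laplacian_entry /= deg_disjoint_union_inr.
have specE (V : finType) (X : sgraph V) : char_poly (laplacian R X) =
    \prod_(x <- laplacian_spectrum R X) ('X - x%:P).
  by case: (symmetric_diagonalization (laplacian_symmetric X)).
have ge_tr : transitive (fun x y : R => y <= x).
  by move=> y x z yx zy; exact: le_trans zy yx.
have ge_total : total (fun x y : R => y <= x) by move=> x y; exact: le_total.
have ge_anti : antisymmetric (fun x y : R => y <= x).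
  by move=> x y; rewrite andbC; exact: le_anti.
(* Both lists are non-increasing and are permutations of each other, hence equal. *)
have -> : laplacian_spectrum R G = merge (fun x y => y <= x)
    (laplacian_spectrum R A) (laplacian_spectrum R B).
  rewrite (specE _ A) (specE _ B) -big_cat /= in char_G.
  rewrite {1}/laplacian_spectrum (eigenvalues_split char_G).
  apply: (sorted_eq ge_tr ge_anti); first exact: sort_sorted.
    by apply: merge_sorted => //; apply: sort_sorted.
  by rewrite perm_sort perm_sym perm_merge.
have [|i [j [ij le_i le_j E]]] := @sum_take_merge R (fun x y => y <= x)
  (laplacian_spectrum R A) (laplacian_spectrum R B) k.
  by rewrite !size_laplacian_spectrum.
exists i, j; rewrite !sum_nth_take; split=> //.
  by rewrite -(size_laplacian_spectrum A).
by rewrite -(size_laplacian_spectrum B).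
Qed.

End LaplacianSpectrum.

(** * Majorization for the union [H] *)

Theorem theorem3p4p1 (R : rcfType) (VA VB : finType)
  (A : sgraph VA) (B : sgraph VB) (C : sgraph (VA + VB)%type)
  (C_edge : exists x y, C x y)
  (C_across : forall x y, C x y ->
     exists a b, (x = inl a /\ y = inr b) \/ (x = inr b /\ y = inl a))
  (majA : majorized (laplacian_spectrum R A) (conj_deg_seq R A))
  (majB : majorized (laplacian_spectrum R B) (conj_deg_seq R B))
  (majC : majorized (laplacian_spectrum R C) (conj_deg_seq R C))
  (CleA : forall i, (1 <= i)%N -> (conj_deg C i <= conj_deg A i)%N)
  (CleB : forall i, (1 <= i)%N -> (conj_deg C i <= conj_deg B i)%N)
  (m : nat) (m_ge1 : (1 <= m)%N) (m_nz : conj_deg C m <> 0%N)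
  (m_max : forall j, (m < j)%N -> conj_deg C j = 0%N)
  (BleA : (conj_deg B 1 <= conj_deg A m)%N) :
  let G := disjoint_union A B in
  let H := graph_union C G in
  majorized (laplacian_spectrum R H) (conj_deg_seq R H).
Proof.
move=> G H; apply/majorized_laplacianP => k le_kV.
move/majorized_laplacianP in majA; move/majorized_laplacianP in majB.
move/majorized_laplacianP in majC.
(* Degrees add, and no pair is an edge of both [C] and [G], so the entries [-1] never overlap. *)
have lapH : laplacian R H = laplacian R C + laplacian R G.
  apply/matrixP => i j; rewrite !laplacianE !mxE /laplacian_entry.
  rewrite (deg_graph_union A B C_across) natrD /= /graph_union_adj.
  case: eqP => // _; case CE: (C _ _); last by rewrite add0r.
  by have /= -> := cross_disjoint A B C_across CE; rewrite addr0.
rewrite /laplacian_spectrum lapH.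
have Csym := laplacian_symmetric R C; have Gsym := laplacian_symmetric R G.
apply: le_trans (ky_fan Csym Gsym le_kV) _.
have [|i [j [ij le_i le_j GE]]] := @sum_spectrum_disjoint_union R _ _ A B k.
  by rewrite -card_sum.
rewrite -/(laplacian_spectrum R G) GE.
(* The three majorizations turn eigenvalue sums into conjugate degree sums, which leaves an
   inequality of natural numbers. *)
apply: le_trans (lerD (majC _ le_kV) (lerD (majA _ le_i) (majB _ le_j))) _.
rewrite -!natrD ler_nat -ij.
exact: (sum_conj_deg_union C_across CleB m_max BleA).
Qed.
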